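(* Let $d\ge 3$ and let $\eta$ be an $\mathbb{N}$-valued random variable with $\mathbf{P}[\eta\ge1]>0$. Suppose that there exists $\beta<\frac{\log(d-1)}{2\log d}$ such that \[ \mathbf{P}[\eta\ge n]\ge\frac{1}{n^\beta} \] for all $n$ large enough. Then $p_u(\mathbb{T}_d,\eta)<1$.
   Context: Here $\mathbb{N}=\{0,1,2,\dots\}$, and $\mathbb{T}_d$ denotes the infinite homogeneous tree in which every vertex has degree $d$, with a fixed root $\mathbf{0}$. Frog model $\mathrm{FM}(\mathcal{G},p,\eta)$. Let $\mathcal{G}$ be an infinite connected undirected graph all of whose sites (vertices) have finite degree, with a fixed site $\mathbf{0}$ called the root; let $p\in[0,1]$ and let $\eta$ be a random variable with values in $\mathbb{N}$. Let $\{\eta(x)\}_{x}$, $\{(S^x_n(i))_{n\in\mathbb{N}}\}_{x,\,i\ge1}$, $\{\Xi^x_p(i)\}_{x,\,i\ge 1}$ be independent families of independent random variables, where $\eta(x)$ has the law of $\eta$, $(S^x_n(i))_n$ is a discrete-time simple random walk on $\mathcal{G}$ started from $x$, and $\mathbf{P}[\Xi^x_p(i)=k]=(1-p)p^{k-1}$, $k=1,2,\dots$ (for $p=1$, $\Xi^x_p(i)=\infty$, no death). Site $x$ initially contains $\eta(x)$ particles; at time $0$ all particles are sleeping except those at the root, which are active. If the particles of site $x$ are activated at time $T(x)$, the $i$-th of them ($1\le i\le\eta(x)$) is active and located at $S^x_n(i)$ at time $T(x)+n$ for $0\le n<\Xi^x_p(i)$, and then disappears. When an active particle visits a site, all sleeping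 particles there become active. Formally, $t(x,y)=\min_{1\le i\le\eta(x)}\min\{n<\Xi^x_p(i):S^x_n(i)=y\}$ for $x\ne y$ ($\infty$ if there is no such $n$), and $T(x)=\inf\{t(x_0,x_1)+\dots+t(x_{m-1},x_m)\}$ over all finite sequences $\mathbf{0}=x_0,x_1,\dots,x_m=x$, with $T(\mathbf{0})=0$; $T(x)=\infty$ means that $x$ is never visited by active particles. The root is hit infinitely often if there are infinitely many times at which some active particle is located at $\mathbf{0}$. Define $p_u(\mathcal{G},\eta)=\inf\{p\in[0,1]:\mathbf{P}[\mathbf{0}\text{ is hit infinitely often in }\mathrm{FM}(\mathcal{G},p,\eta)]>0\}$, with the convention $\inf\emptyset=1$. *)

(* Defs.v *)
From HB Require Import structures.
From mathcomp Require Import all_boot all_order all_algebra.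
From mathcomp Require Import all_classical all_reals all_analysis.

Set Implicit Arguments.
Unset Strict Implicit.
Unset Printing Implicit Defensive.
Import Order.TTheory GRing.Theory Num.Theory.
Local Open Scope classical_set_scope.
Local Open Scope ring_scope.

(* Simple, undirected, connected, infinite, locally finite graphs. A connected
   locally finite graph is countable, so taking a countType of vertices loses
   nothing. *)
Record graph := Graph {
  vertex :> countType;
  neighbors : vertex -> seq vertex;
  neighbors_uniq : forall x, uniq (neighbors x);
  neighbors_irr : forall x, x \notin neighbors x;
  neighbors_sym : forall x y, (x \in neighbors y) = (y \in neighbors x);
  graph_connected : forall x y,
    exists s, path [rel u v | v \in neighbors u] x s /\ last x s = y;
  graph_infinite : infinite_set [set: vertex]
}.

Definition adj (G : graph) : rel G := [rel x y | y \in neighbors x].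

Definition degree (G : graph) (x : G) : nat := size (neighbors x).

(* A cycle of a simple graph has at least 3 vertices; the sequence [:: x; y]
   of the two ends of an edge satisfies [cycle (@adj G)]. *)
Definition acyclic (G : graph) : Prop :=
  forall c : seq G, (2 < size c)%N -> uniq c -> ~~ cycle (@adj G) c.

Definition homogeneous_tree (d : nat) (G : graph) : Prop :=
  acyclic G /\ forall x : G, degree x = d.

Section Independence.
Context {d : measure_display} {T : measurableType d} {R : realType}.

Definition mutually_independent (P : probability T R) (I : eqType)
    (F : I -> set_system T) : Prop :=
  forall (s : seq I) (A : I -> set T), uniq s ->
    (forall i, i \in s -> F i (A i)) ->
    (P (\big[setI/setT]_(i <- s) A i) = \prod_(i <- s) P (A i))%E.

End Independence.

(* The sigma-algebra generated by a random element of a discrete space, and the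
   one generated by a sequence of such elements. *)
Definition sigma_of (Omega E : Type) (X : Omega -> E) : set_system Omega :=
  [set A | exists B : set E, A = X @^-1` B].

Definition sigma_of_seq (Omega E : Type) (X : nat -> Omega -> E) :
    set_system Omega :=
  <<s [set A | exists (n : nat) (B : set E), A = X n @^-1` B] >>.

(* The probability that a simple random walk started from [x] follows
   [w 0, ..., w n]. *)
Definition srw_prob (R : realType) (G : graph) (x : G) (w : nat -> G)
    (n : nat) : R :=
  (w 0 == x)%:R *
  \prod_(k < n) ((adj (w k) (w k.+1))%:R / (degree (w k))%:R).

(* A realization of FM(G, p, eta), where [law] is the law of eta.  The particles
   of a site are numbered from 0, and a lifetime [None] is infinite; since the
   weights (1 - p) p ^ k add up to 1 for p < 1, infinite lifetimes only need to
   be specified for p = 1. *)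
Record frog_model (R : realType) (G : graph) (p : R) (law : probability nat R)
    := FrogModel {
  fm_disp : measure_display;
  fm_space : measurableType fm_disp;
  fm_prob : probability fm_space R;
  eta_ : G -> fm_space -> nat;
  walk : G -> nat -> nat -> fm_space -> G;
  lifetime : G -> nat -> fm_space -> option nat;
  eta_meas : forall x (B : set nat), measurable (eta_ x @^-1` B);
  walk_meas : forall x i n (B : set G), measurable (walk x i n @^-1` B);
  lifetime_meas : forall x i (B : set (option nat)),
    measurable (lifetime x i @^-1` B);
  eta_law : forall x (B : set nat), fm_prob (eta_ x @^-1` B) = law B;
  walk_law : forall x i (w : nat -> G) n,
    fm_prob [set omega | forall k, (k <= n)%N -> walk x i k omega = w k] =
    (srw_prob R x w n)%:E;
  lifetime_law : forall x i k,
    fm_prob [set omega | lifetime x i omega = Some k.+1] =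
    ((1 - p) * p ^+ k)%:E;
  lifetime_law1 : forall x i, p = 1 ->
    fm_prob [set omega | lifetime x i omega = None] = 1%E;
  fm_indep : mutually_independent fm_prob
    (fun j : G + (G * nat) + (G * nat) =>
       match j with
       | inl (inl x) => sigma_of (eta_ x)
       | inl (inr (x, i)) => sigma_of_seq (walk x i)
       | inr (x, i) => sigma_of (lifetime x i)
       end)
}.

Section Dynamics.
Context {R : realType} {G : graph} {p : R} {law : probability nat R}.
Variables (M : frog_model G p law) (omega : fm_space M).

Definition alive (x : G) (i n : nat) : bool :=
  if lifetime x i omega is Some l then (n < l)%N else true.

(* The [i]-th particle of [x] exists, and its walk is at [y] at step [n] of its
   life. *)
Definition particle_at (x : G) (i n : nat) (y : G) : Prop :=
  [/\ (i < eta_ x omega)%N, alive x i n & walk x i n omega = y].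

Definition transit_time (x y : G) : \bar R :=
  ereal_inf [set n%:R%:E | n in [set n | exists i, particle_at x i n y]].

Fixpoint path_time (x : G) (s : seq G) : \bar R :=
  if s is y :: s' then (transit_time x y + path_time y s')%E else 0%E.

Definition activation_time (o x : G) : \bar R :=
  ereal_inf [set path_time o s | s in
    [set s | path [rel u v | u != v] o s /\ last o s = x]].

Definition root_hit_times (o : G) : set nat :=
  [set m | exists (x : G) (i n : nat),
     (activation_time o x + n%:R%:E = m%:R%:E)%E /\ particle_at x i n o].

End Dynamics.

Definition root_hit_io (R : realType) (G : graph) (p : R)
    (law : probability nat R) (M : frog_model G p law) (o : G) :
    set (fm_space M) :=
  [set omega | infinite_set (root_hit_times omega o)].

(* The probabilities involved only depend on G, p and the law of eta, not on the
   realizations [M]. *)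
Definition p_u (R : realType) (G : graph) (o : G) (law : probability nat R)
    (M : forall p : R, 0 <= p <= 1 -> frog_model G p law) : R :=
  let A := [set p : R | exists hp : 0 <= p <= 1,
                          (0 < fm_prob (M p hp) (root_hit_io o))%E] in
  if `[< A = set0 >] then 1 else inf A.

(* Main.v *)
(* Let N_n grow like a^n with d^2 < a and a^beta < d - 1, which the bound on beta
   allows. Among the at least (d-1)^n vertices of the ball of radius n, some
   vertex carries N_n particles except with superexponentially small
   probability. For p close to 1, N_n also exceeds (d/p)^(2n+1) exponentially,
   and a given walk of length at most 2n+1 is followed by a living particle with
   probability of order (p/d)^(2n+1); so the N_n particles of one such vertex
   visit the whole ball of radius n+1, and the root after at least n steps, again
   except with superexponentially small probability. Hence if the root itself
   carries N_n0 particles, which has probability at least c (d-1)^(-n0), then for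
   n0 large and with positive probability every ball gets activated in turn, and
   the root is hit at arbitrarily late times. *)
Require Import Defs.
From HB Require Import structures.
From mathcomp Require Import all_boot all_order all_algebra.
From mathcomp Require Import all_classical all_reals all_analysis.
From mathcomp Require Import zify ring lra.
Set Implicit Arguments.
Unset Strict Implicit.
Unset Printing Implicit Defensive.
Import Order.TTheory GRing.Theory Num.Theory.
Local Open Scope classical_set_scope.
Local Open Scope ring_scope.

(** * Trees *)

Lemma adj_sym (G : graph) : symmetric (@adj G).
Proof. by move=> x y; rewrite /adj /= neighbors_sym. Qed.

(** Where two simple paths first diverge, following one until it meets the other again and then the
    other backwards closes a cycle. *)
Lemma acyclic_simple_path_uniq (G : graph) : acyclic G ->
  forall (s1 s2 : seq G) (x : G),
  path (@adj G) x s1 -> path (@adj G) x s2 ->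
  uniq (x :: s1) -> uniq (x :: s2) -> last x s1 = last x s2 -> s1 = s2.
Proof.
move=> acG; elim=> [|a s1 IH] [|b s2] x //.
- by move=> _ _ _ /=/andP[+ _] e; rewrite e mem_last.
- by move=> _ _ /= /andP[+ _] _ e; rewrite -e mem_last.
move=> P1 P2 U1 U2 E.
have [ab|ab] := eqVneq a b.
  move: P1 P2 U1 U2 E; rewrite -ab /= => /andP[_ P1] /andP[_ P2].
  by case/andP=> _ U1 /andP[_ U2] E; rewrite (IH s2 a).
have hz : has (mem (b :: s2)) (a :: s1).
  apply/hasP; exists (last a s1); first exact: mem_last.
  by move: E => /= ->; exact: mem_last.
exfalso; move: ab; have [ea ed] : a = head x (a :: s1) /\ b = head x (b :: s2) by [].
rewrite {}ea {}ed; move: P1 P2 U1 U2 hz; move: (a :: s1) (b :: s2) => {E IH a b} u v.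
move=> P1 P2 U1 U2 hz.
case/split_find: hz P1 U1 => z t1 t1' zv nt1.
case/splitPr: zv P2 U2 nt1 => t2 t2'.
move=> P2 U2 nt1 P1 U1 /eqP hd.
have Pz1 : path (@adj G) x (rcons t1 z) by move: P1; rewrite cat_path => /andP[].
have Pz2 : path (@adj G) x (rcons t2 z).
  by move: P2; rewrite -cat_rcons cat_path => /andP[].
(* Here [z] is the first vertex of one path that lies on the other. The cycle has at least 3
   vertices: [t1] and [t2] are not both empty, since the paths differ in their first step. *)
have := acG (x :: rcons t1 z ++ rev t2).
have -> : uniq (x :: rcons t1 z ++ rev t2).
  move: U1 U2; rewrite /= !mem_cat !cat_uniq !rcons_uniq !mem_rcons !inE !mem_rev.
  rewrite rev_uniq /=.
  rewrite !negb_or.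
  case/andP=> /andP[/andP[-> ->] _] /andP[/andP[-> ->] _].
  case/andP=> /andP[-> _] /andP[-> ] /andP[] /andP[zt2 _] _ /=.
  rewrite andbT; apply/hasPn => w; rewrite mem_rev mem_rcons inE => wt2.
  apply/negP => /orP[/eqP wz|wt1]; first by rewrite -wz wt2 in zt2.
  by move/hasPn: nt1 => /(_ w wt1) /=; rewrite mem_cat wt2.
have -> : cycle (@adj G) (x :: rcons t1 z ++ rev t2).
  rewrite /= rcons_cat cat_path Pz1 last_rcons /=.
  move: Pz2; rewrite -rev_path last_rcons belast_rcons rev_cons.
  by rewrite (eq_path (e' := @adj G)) // => ? ?; rewrite adj_sym.
have -> : (2 < size (x :: rcons t1 z ++ rev t2))%N.
  rewrite /= size_cat size_rcons size_rev.
  case: t1 hd {P1 U1 Pz1 nt1} => [|? ?]; case: t2 {P2 U2 Pz2} => [|? ?] //=; lia.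
by move=> /(_ isT isT).
Qed.

(** A list with repetitions: in a regular graph its length is an exact power, which suffices for
    union bounds. Distinct vertices come from [tree_growth]. *)
Fixpoint graph_ball (G : graph) (o : G) (n : nat) : seq G :=
  if n is n'.+1 then graph_ball o n' ++ flatten [seq neighbors x | x <- graph_ball o n']
  else [:: o].

Lemma size_graph_ball (G : graph) (o : G) (d n : nat) :
  (forall x : G, degree x = d) -> size (graph_ball o n) = (d.+1 ^ n)%N.
Proof.
move=> dG; elim: n => //= n IH.
rewrite size_cat size_flatten /shape -map_comp.
rewrite (eq_map (g := fun=> d)); last by move=> x /=; exact: dG.
rewrite sumnE big_map big_const_seq count_predT iter_addn_0 IH expnS; lia.
Qed.

Lemma graph_ballP (G : graph) (o x : G) (n : nat) :
  reflect (exists s, [/\ path (@adj G) o s, last o s = x & (size s <= n)%N])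
    (x \in graph_ball o n).
Proof.
elim: n x => [|n IH] x /=.
  rewrite inE; apply: (iffP eqP) => [->|]; first by exists [::].
  by case=> -[|a s] [_ /= ls] //.
rewrite mem_cat; apply: (iffP orP).
  case=> [/IH[s [Ps ls ns]]|]; first by exists s; split => //; exact: leqW.
  case/flatten_mapP=> y /IH[s [Ps ls ns]] yx.
  exists (rcons s x); split; rewrite ?last_rcons ?size_rcons //.
  by rewrite rcons_path Ps ls.
case=> s [Ps ls ns]; case/lastP: s => [|s z] in Ps ls ns *.
  by left; apply/IH; exists [::].
move: Ps ls ns; rewrite rcons_path last_rcons size_rcons => /andP[Ps zs] <- ns.
right; apply/flatten_mapP; exists (last o s) => //.
by apply/IH; exists s.
Qed.

(** Go back to [o] and on to [y], then pad a walk that is too short by steps to a neighbor and back;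
    [m < n] leaves room for the padding. The lower bound on the length will make root hits late. *)
Lemma graph_ball_walk (G : graph) (d : nat) (o x y : G) (m n : nat) :
  (0 < d)%N -> (forall x : G, degree x = d) ->
  x \in graph_ball o m -> y \in graph_ball o n -> (m < n)%N ->
  exists s, [/\ path (@adj G) x s, last x s = y & (m <= size s <= m + n)%N].
Proof.
move=> d0 dG /graph_ballP[s [Ps ls ms]] /graph_ballP[t [Pt lt nt]] mn.
have [u [Pu lu su]] :
    exists u, [/\ path (@adj G) x u, last x u = y & (size u <= m + n)%N].
  exists (rev (belast o s) ++ t); split.
  - rewrite cat_path -ls rev_path.
    have -> : path (fun z => @adj G ^~ z) o s = path (@adj G) o s.
      by apply: eq_path => ? ?; exact: adj_sym.
    rewrite Ps /=; case: s {Ps ms} ls => //= a s _.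
    by rewrite rev_cons last_rcons.
  - rewrite last_cat -ls; case: s {Ps ms} ls => //= a s _.
    by rewrite rev_cons last_rcons.
  - by rewrite size_cat size_rev size_belast leq_add.
have [k] := ubnP (m - size u)%N; elim: k u Pu lu su => // k IH u Pu lu su uk.
have [mu|um] := leqP m (size u); first by exists u; rewrite su mu.
have [z xz] : exists z, z \in neighbors x.
  move: (dG x) d0; rewrite /degree; case: (neighbors x) => [<- //|z l] _ _.
  by exists z; rewrite mem_head.
apply: (IH (z :: x :: u)) => //=; [|lia|lia].
by rewrite Pu /adj /= xz neighbors_sym xz.
Qed.

(* The simple paths of length n from the root, listed from their other end. *)
Fixpoint branches (G : graph) (o : G) (d n : nat) : seq (seq G) :=
  if n is n'.+1 then
    [seq z :: s | s <- branches o d n',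
                  z <- take d [seq z <- neighbors (head o s) | z != nth (head o s) s 1]]
  else [:: [:: o]].

(** An added vertex differs from the one next to the head, so meeting it further back on the path
    would close a cycle. *)
Lemma branchesP (G : graph) (o : G) (d n : nat) (s : seq G) : acyclic G ->
  s \in branches o d n ->
  [/\ path (@adj G) (head o s) (behead s), last (head o s) (behead s) = o,
      uniq s & size s = n.+1].
Proof.
move=> acG; elim: n s => [|n IH] s /=; first by rewrite inE => /eqP->.
case/allpairsPdep=> t [z [tb /mem_take]].
rewrite mem_filter => /andP[zt zN ->] /=.
case: (IH _ tb); case: t zt zN {tb} => // y t zt /= yz Pt lt /andP[yt ut] [st].
rewrite Pt st; split=> //; first by rewrite andbT adj_sym.
rewrite yt ut !andbT inE negb_or.
have -> /= : z != y.
  by apply/eqP => zy; move: yz; rewrite zy (negbTE (neighbors_irr _)).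
apply/negP => zin; case/splitPr: zin zt Pt yt ut {lt st} => t1 t2 zt Pt yt ut.
have := acG (y :: rcons t1 z).
have -> : uniq (y :: rcons t1 z).
  move: yt ut; rewrite /= -cat_rcons mem_cat negb_or cat_uniq.
  by case/andP=> -> _ /andP[].
have -> : cycle (@adj G) (y :: rcons t1 z).
  rewrite /= rcons_path last_rcons; move: Pt; rewrite -cat_rcons cat_path.
  by case/andP=> -> _; rewrite adj_sym.
rewrite /= size_rcons; case: t1 zt {Pt yt ut} => /= [|a t1]; first by rewrite eqxx.
by move=> _ /(_ isT isT).
Qed.

(** At most one of the d + 1 neighbors of the head is filtered out, so [take d] returns exactly d of
    them. For the one-vertex path the default of [nth] is the root itself, and nothing is filtered
    out. *)
Lemma size_branches (G : graph) (o : G) (d n : nat) :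
  homogeneous_tree d.+1 G -> size (branches o d n) = (d ^ n)%N.
Proof.
case=> _ dG; elim: n => //= n IH; rewrite size_allpairs_dep.
rewrite (eq_map (g := fun=> d)).
  by rewrite sumnE big_map big_const_seq count_predT iter_addn_0 IH expnS.
move=> s /=; rewrite size_take; set f := seq.filter _ _.
suff : (d <= size f)%N by rewrite leq_eqVlt => /predU1P[<-|->]; rewrite ?ltnn.
have := dG (head o s); rewrite /degree; set x := head o s => dx.
rewrite -ltnS -dx -(count_predC (predC1 (nth x s 1)) (neighbors x)).
rewrite /f size_filter -[leqRHS]addn1 leq_add2l.
rewrite (eq_count (a2 := pred1 (nth x s 1))); last by move=> z /=; rewrite negbK.
by rewrite count_uniq_mem ?neighbors_uniq // leq_b1.
Qed.

Lemma uniq_branches (G : graph) (o : G) (d n : nat) :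
  uniq (branches o d n).
Proof.
elim: n => //= n IH; apply: allpairs_uniq_dep => //.
  by move=> s _; rewrite take_uniq // filter_uniq // neighbors_uniq.
by move=> [s z] [t y] _ _ /= [-> ->].
Qed.

(** Simple paths between given ends are unique, so distinct branches have distinct ends.
    Independence of the particle numbers calls for distinct vertices. *)
Lemma tree_growth (G : graph) (o : G) (d n : nat) :
  homogeneous_tree d.+1 G ->
  exists s : seq G, [/\ uniq s, {subset s <= graph_ball o n} & size s = (d ^ n)%N].
Proof.
move=> tG; have [acG dG] := tG.
exists [seq head o s | s <- branches o d n]; split.
- rewrite map_inj_in_uniq ?uniq_branches // => s t /(branchesP acG) + /(branchesP acG).
  case: s t => [|x s] [|y t] [] //= Ps ls us ss [] // Pt lt ut st xy; rewrite xy.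
  rewrite -xy in Pt lt ut *.
  by rewrite (acyclic_simple_path_uniq acG Ps Pt us ut) ?ls ?lt.
- move=> x /mapP[s /(branchesP acG)[Ps ls us ss] ->]; apply/graph_ballP.
  exists (rev (belast (head o s) (behead s))).
  case: s Ps ls {us} ss => //= y s Ps ls [ss]; split.
  + rewrite -{1}ls rev_path; apply: sub_path Ps => u v; by rewrite adj_sym.
  + by case: s Ps ls {ss} => //= a s _ _; rewrite rev_cons last_rcons.
  + by rewrite size_rev size_belast ss.
- by rewrite size_map size_branches.
Qed.

(** * Activation times *)

Definition nat_or_infty (R : realType) (x : \bar R) : Prop :=
  x = +oo%E \/ exists n : nat, x = n%:R%:E.

Lemma nat_or_inftyD (R : realType) (x y : \bar R) :
  nat_or_infty x -> nat_or_infty y -> nat_or_infty (x + y)%E.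
Proof.
case=> [->|[m ->]] [->|[n ->]]; try by left.
by right; exists (m + n)%N; rewrite natrD EFinD.
Qed.

(** A finite infimum is attained, by well-ordering. The equivalence turns an equation on an infimum
    into memberships whose measurability can be checked one by one. *)
Lemma ereal_inf_nat (R : realType) (S : set (\bar R)) :
  (forall x, S x -> nat_or_infty x) ->
  nat_or_infty (ereal_inf S) /\
  forall m : nat, ereal_inf S = m%:R%:E <->
    S m%:R%:E /\ forall k : nat, (k < m)%N -> ~ S k%:R%:E.
Proof.
move=> natS; have [[n Sn]|noS] := pselect (exists n : nat, S n%:R%:E).
  have exS : exists n : nat, `[< S n%:R%:E >] by exists n; apply/asboolP.
  case: (ex_minnP exS) => m0 /asboolP Sm0 min0.
  have infS : ereal_inf S = m0%:R%:E.
    apply/eqP; rewrite eq_le ereal_inf_lbound //=.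
    apply: le_ereal_inf_tmp => x Sx.
    have [xy|[k xk]] := natS _ Sx; first by rewrite xy leey.
    by rewrite xk lee_fin ler_nat min0 //; apply/asboolP; rewrite -xk.
  split; first by right; exists m0.
  move=> m; rewrite infS; split.
    move=> [/eqP]; rewrite eqr_nat => /eqP <-; split=> // k km Sk.
    by move: (min0 k); rewrite leqNgt km => /(_ (asboolT Sk)).
  case=> Sm minm; congr (_%:R%:E); apply/eqP; rewrite eqn_leq min0; last exact/asboolP.
  by rewrite leqNgt; apply/negP => /minm.
have infS : ereal_inf S = +oo%E.
  apply/eqP; rewrite -leye_eq; apply: le_ereal_inf_tmp => x Sx.
  by have [->//|[k xk]] := natS _ Sx; case: noS; exists k; rewrite -xk.
split; first by left.
by move=> m; rewrite infS; split=> // -[Sm _]; case: noS; exists m.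
Qed.

(** * Measurability of countable quantifications *)

Section measurable_predicates.
Context {disp : measure_display} {T : measurableType disp}.

Lemma measurable_exists (U : countType) (Q : U -> T -> Prop) :
  (forall u, measurable [set w : T | Q u w]) ->
  measurable [set w : T | exists u, Q u w].
Proof.
move=> mQ; rewrite (_ : mkset _ = \bigcup_u [set w : T | Q u w]).
  exact: countable_bigcupT_measurable.
by apply/seteqP; split=> w /= [u] => [Qu|_ Qu]; exists u.
Qed.

Lemma measurable_forall (U : countType) (Q : U -> T -> Prop) :
  (forall u, measurable [set w : T | Q u w]) ->
  measurable [set w : T | forall u, Q u w].
Proof.
move=> mQ; rewrite (_ : mkset _ = ~` [set w : T | exists u, ~ Q u w]).
  by apply/measurableC/measurable_exists => u; exact: measurableC (mQ u).
apply/seteqP; split=> w /=; first by move=> Qw [u]; exact.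
by move=> nQ u; apply: contrapT => nQu; apply: nQ; exists u.
Qed.

Lemma measurable_imply (a : Prop) (Q : T -> Prop) :
  measurable [set w : T | Q w] ->
  measurable [set w : T | a -> Q w].
Proof.
move=> mQ; have [ha|na] := pselect a.
  rewrite (_ : mkset _ = [set w : T | Q w]) //.
  by apply/seteqP; split=> w /= => [/(_ ha)|].
by rewrite (_ : mkset _ = setT) //; apply/seteqP; split=> w //= _ /na.
Qed.

Lemma measurable_and_prop (a : Prop) (Q : T -> Prop) :
  measurable [set w : T | Q w] ->
  measurable [set w : T | a /\ Q w].
Proof.
move=> mQ; have [ha|na] := pselect a.
  rewrite (_ : mkset _ = [set w : T | Q w]) //.
  by apply/seteqP; split=> w /= => [[]|].
rewrite (_ : mkset _ = set0) //; by apply/seteqP; split=> w /= => [[]|].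
Qed.

Lemma measurable_first (Q : nat -> T -> Prop) (m : nat) :
  (forall k, measurable [set w : T | Q k w]) ->
  measurable [set w : T | Q m w /\ forall k, (k < m)%N -> ~ Q k w].
Proof.
move=> mQ; apply: measurableI; first exact: mQ.
apply: (@measurable_forall nat (fun k w => (k < m)%N -> ~ Q k w)) => k.
by apply: measurable_imply; exact: measurableC (mQ k).
Qed.

End measurable_predicates.

(** * Propagation of activity, and measurability of the root hits *)

Section dynamics.
Context {R : realType} {G : graph} {p : R} {law : probability nat R}.
Variable M : frog_model G p law.
Implicit Types (omega : fm_space M) (x y o : G) (s : seq G).

Lemma transit_timeP omega x y : nat_or_infty (transit_time omega x y) /\
  forall m : nat, transit_time omega x y = m%:R%:E <->
    (exists i, particle_at omega x i m y) /\
    forall k, (k < m)%N -> ~ exists i, particle_at omega x i k y.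
Proof.
have img (m : nat) : [set n%:R%:E | n in [set n | exists i, particle_at omega x i n y]]
    (m%:R%:E : \bar R) <-> exists i, particle_at omega x i m y.
  split=> [[n /= + [/eqP]]|]; last by exists m.
  by rewrite eqr_nat => + /eqP <-.
have [|? H] := @ereal_inf_nat R
  [set n%:R%:E | n in [set n | exists i, particle_at omega x i n y]].
  by move=> _ [n _ <-]; right; exists n.
split=> // m; rewrite -img; split=> [/H[? Hk]|[? Hk]].
  by split=> // k /Hk + /img.
by apply/H; split=> // k /Hk + /img.
Qed.

Lemma path_time_nat omega x s : nat_or_infty (path_time omega x s).
Proof.
elim: s x => [|y s IH] x /=; first by right; exists 0%N.
by apply: nat_or_inftyD; [exact: (transit_timeP _ _ _).1|exact: IH].
Qed.

Lemma path_time_rcons omega x s y :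
  path_time omega x (rcons s y) =
  (path_time omega x s + transit_time omega (last x s) y)%E.
Proof.
elim: s x => [|z s IH] x /=; first by rewrite adde0 add0e.
by rewrite IH addeA.
Qed.

Definition activated omega o x : Prop :=
  exists m : nat, activation_time omega o x = m%:R%:E.

Lemma activation_timeP omega o x : nat_or_infty (activation_time omega o x) /\
  forall m : nat, activation_time omega o x = m%:R%:E <->
    (exists2 s, path [rel u v | u != v] o s /\ last o s = x &
       path_time omega o s = m%:R%:E) /\
    forall k, (k < m)%N -> ~ exists2 s, path [rel u v | u != v] o s /\ last o s = x &
       path_time omega o s = k%:R%:E.
Proof.
have [|? H] := @ereal_inf_nat R [set path_time omega o s | s in
    [set s | path [rel u v | u != v] o s /\ last o s = x]].
  by move=> _ [s _ <-]; exact: path_time_nat.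
by split.
Qed.

Lemma activatedP omega o x : activated omega o x <->
  exists s, [/\ path [rel u v | u != v] o s, last o s = x &
     exists m : nat, path_time omega o s = m%:R%:E].
Proof.
split=> [[m /(activation_timeP _ _ _).2[[s [Ps ls] sm] _]]|[s [Ps ls [m sm]]]].
  by exists s; split=> //; exists m.
have [[oo|//] _] := activation_timeP omega o x.
suff : (activation_time omega o x <= m%:R%:E)%E by rewrite oo.
by apply: ereal_inf_lbound; exists s.
Qed.

Lemma activated_root omega o : activated omega o o.
Proof. by apply/activatedP; exists [::]; split => //; exists 0%N. Qed.

Lemma activated_step omega o x y i n :
  activated omega o x -> particle_at omega x i n y -> activated omega o y.
Proof.
(* Paths in [activation_time] have distinct consecutive vertices, hence the separate case x = y. *)
move=> ax xy; have [<- //|neq] := eqVneq x y.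
case/activatedP: (ax) => s [Ps ls [m sm]]; apply/activatedP.
have [[oo|[k tk]] _] := transit_timeP omega x y.
  suff : (transit_time omega x y <= n%:R%:E)%E by rewrite oo.
  by apply: ereal_inf_lbound; exists n => //; exists i.
exists (rcons s y); split; rewrite ?last_rcons ?rcons_path ?Ps /= ?ls //.
by exists (m + k)%N; rewrite path_time_rcons ls sm tk natrD EFinD.
Qed.

(** The age of the particle bounds the hitting time from below, so long walks give late hits. *)
Lemma root_hit_activated omega o x i n :
  activated omega o x -> particle_at omega x i n o ->
  exists2 m, (n <= m)%N & root_hit_times omega o m.
Proof.
case=> m xm xo; exists (m + n)%N; first exact: leq_addl.
by exists x, i, n; split=> //; rewrite xm natrD EFinD.
Qed.

Lemma measurable_particle_at x i n y :
  measurable [set omega : fm_space M | particle_at omega x i n y].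
Proof.
rewrite (_ : mkset _ = (eta_ (f:=M) x @^-1` [set e | (i < e)%N]) `&`
   (lifetime (f:=M) x i @^-1` [set l : option nat |
      is_true (if l is Some l then (n < l)%N else true)]) `&`
   (walk (f:=M) x i n @^-1` [set y])).
  apply: measurableI; first apply: measurableI.
  - exact: eta_meas.
  - exact: lifetime_meas.
  - exact: walk_meas.
by apply/seteqP; split=> w /=; [case|case=> -[]].
Qed.

Lemma measurable_transit_time x y (m : nat) :
  measurable [set omega : fm_space M | transit_time omega x y = m%:R%:E].
Proof.
under eq_set => omega do rewrite (propext ((transit_timeP omega x y).2 m)).
apply: (@measurable_first _ _ (fun m omega => exists i, particle_at omega x i m y)) => k.
by apply: measurable_exists => i; exact: measurable_particle_at.
Qed.

Lemma measurable_path_time x s (m : nat) :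
  measurable [set omega : fm_space M | path_time omega x s = m%:R%:E].
Proof.
elim: s x m => [|y s IH] x m /=.
  have [->|m0] := eqVneq m 0%N.
    by rewrite (_ : mkset _ = setT) //; apply/seteqP; split.
  rewrite (_ : mkset _ = set0) //; apply/seteqP; split=> w //= -[/eqP].
  by rewrite -[0]/(0%:R) eqr_nat eq_sym (negbTE m0).
(* A finite sum has finite terms, so the event splits over the pairs with k + l = m. *)
rewrite (_ : mkset _ = [set omega : fm_space M | exists k, exists l, (k + l = m)%N /\
   (transit_time omega x y = k%:R%:E /\ path_time omega y s = l%:R%:E)]).
  do 2 apply: measurable_exists => ?; apply: measurable_and_prop.
  by apply: measurableI; [exact: measurable_transit_time|exact: IH].
apply/seteqP; split=> w /=; last first.
  by case=> k [l [<- [-> ->]]]; rewrite natrD EFinD.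
have [[->|[k ->]] _] := transit_timeP w x y.
  by case: (path_time_nat w y s) => [->|[l ->]].
have [->|[l ->]] := path_time_nat w y s; first by [].
rewrite -EFinD -natrD => -[/eqP]; rewrite eqr_nat => /eqP klm.
by exists k, l.
Qed.

Lemma measurable_activation_time o x (m : nat) :
  measurable [set omega : fm_space M | activation_time omega o x = m%:R%:E].
Proof.
under eq_set => omega do rewrite (propext ((activation_timeP omega o x).2 m)).
apply: (@measurable_first _ _ (fun m omega =>
  exists2 s, path [rel u v | u != v] o s /\ last o s = x &
       path_time omega o s = m%:R%:E)) => k.
rewrite (_ : mkset _ = [set omega : fm_space M | exists s,
   (path [rel u v | u != v] o s /\ last o s = x) /\ path_time omega o s = k%:R%:E]).
  apply: measurable_exists => s; apply: measurable_and_prop.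
  exact: measurable_path_time.
by apply/seteqP; split=> w /= [s]; [exists s|case; exists s].
Qed.

Lemma infinite_set_natP (S : set nat) :
  infinite_set S <-> forall n, exists m, (n <= m)%N /\ S m.
Proof.
split=> [infS n|H /finite_seqP[s Ss]].
  apply: contrapT => noS; apply: infS; apply: (sub_finite_set _ (finite_II n)) => m Sm /=.
  by rewrite ltnNge; apply/negP => nm; apply: noS; exists m.
have [m [+ Sm]] := H (\max_(i <- s) i).+1.
move: Sm; rewrite Ss /= => ms; rewrite ltnNge => /negP; apply.
exact: (@leq_bigmax_seq _ s xpredT id m).
Qed.

(** Measurability allows the comparison with a smaller event of positive probability. *)
Lemma measurable_root_hit_io o : measurable (root_hit_io (M := M) o).
Proof.
rewrite /root_hit_io; under eq_set => omega do rewrite (propext (infinite_set_natP _)).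
apply: measurable_forall => n; apply: measurable_exists => m.
apply: measurable_and_prop; rewrite /root_hit_times /=.
apply: measurable_exists => x; apply: measurable_exists => i.
apply: measurable_exists => j.
apply: measurableI; last exact: measurable_particle_at.
rewrite [X in measurable X](_ : _ = [set omega : fm_space M | exists k, (k + j = m)%N /\
    activation_time omega o x = k%:R%:E]).
  apply: measurable_exists => k; apply: measurable_and_prop.
  exact: measurable_activation_time.
apply/seteqP; split=> w /=; last first.
  by case=> k [<- ->]; rewrite natrD EFinD.
have [[->|[k ->]] _] := activation_timeP w o x; first by [].
rewrite -EFinD -natrD => -[/eqP]; rewrite eqr_nat => /eqP klm.
by exists k.
Qed.
End dynamics.

(** * Independence *)

Section finite_families.
Context {disp : measure_display} {T : measurableType disp} {R : realType}.
Variable P : probability T R.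

Lemma measurable_bigsetI (I : eqType) (A : I -> set T) (s : seq I) :
  (forall i, i \in s -> measurable (A i)) ->
  measurable (\big[setI/setT]_(i <- s) A i).
Proof.
elim: s => [|i s IH] mA; first by rewrite big_nil.
rewrite big_cons; apply: measurableI; first by apply: mA; rewrite mem_head.
by apply: IH => j js; apply: mA; rewrite inE js orbT.
Qed.

Lemma union_bound (I : eqType) (A : I -> set T) (s : seq I) (b : R) :
  (forall i, i \in s -> measurable (A i)) ->
  (forall i, i \in s -> (P (A i) <= b%:E)%E) ->
  measurable (\big[setU/set0]_(i <- s) A i) /\
  (P (\big[setU/set0]_(i <- s) A i) <= ((size s)%:R * b)%:E)%E.
Proof.
elim: s => [|i s IH] mA Ab; first by rewrite big_nil measure0 mul0r.
have [mU Ub] : measurable (\big[setU/set0]_(i <- s) A i) /\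
    (P (\big[setU/set0]_(i <- s) A i) <= ((size s)%:R * b)%:E)%E.
  by apply: IH => j js; [apply: mA|apply: Ab]; rewrite inE js orbT.
have mAi : measurable (A i) by apply: mA; rewrite mem_head.
rewrite big_cons; split; first exact: measurableU.
apply: (le_trans (measureU2 _ mAi mU)).
by rewrite /= -[(size s).+1]addn1 natrD mulrDl mul1r addrC EFinD leeD // Ab ?mem_head.
Qed.

(** Independence passes to complements of intersections over disjoint blocks, by induction on the
    blocks. The extra list [t] lets the induction hypothesis absorb the block being removed. *)
Lemma independent_blocks (I : eqType) (F : I -> set_system T) (A : I -> set T)
    (q : I -> R) (ss : seq (seq I)) (t : seq I) :
  mutually_independent P F -> uniq (flatten ss ++ t) ->
  (forall i, i \in flatten ss ++ t ->
     [/\ F i (A i), measurable (A i) & P (A i) = (q i)%:E]) ->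
  P (\big[setI/setT]_(s <- ss) ~` (\big[setI/setT]_(i <- s) A i) `&`
     \big[setI/setT]_(i <- t) A i) =
  (\prod_(s <- ss) (1 - \prod_(i <- s) q i) * \prod_(i <- t) q i)%:E.
Proof.
move=> indF; elim: ss t => [|s ss IH] t /=.
  move=> ut FA; rewrite !big_nil setTI mul1r indF //; last by move=> i /FA[].
  rewrite -prodEFin !big_seq; apply: eq_bigr => i /FA[] //.
rewrite -catA => ust FA.
have sub i : i \in flatten ss ++ (s ++ t) -> i \in s ++ flatten ss ++ t.
  by rewrite !mem_cat orbCA.
have sub' i : i \in flatten ss ++ t -> i \in s ++ flatten ss ++ t.
  by rewrite !mem_cat => ->; rewrite orbT.
have IH1 := IH t; have IH2 := IH (s ++ t).
have {}IH1 := IH1 (subseq_uniq (suffix_subseq s _) ust) (fun i it => FA i (sub' i it)).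
have {}IH2 : P (\big[setI/setT]_(s <- ss) ~` (\big[setI/setT]_(i <- s) A i) `&`
     \big[setI/setT]_(i <- s ++ t) A i) =
  (\prod_(s <- ss) (1 - \prod_(i <- s) q i) * \prod_(i <- s ++ t) q i)%:E.
  by apply: IH2 => [|i it]; [rewrite uniq_catCA|exact: FA (sub i it)].
rewrite big_cat /= in IH2; rewrite !big_cons.
set D := \big[setI/setT]_(s <- ss) ~` _ in IH1 IH2 *.
set B := \big[setI/setT]_(i <- s) A i in IH2 *.
set C := \big[setI/setT]_(i <- t) A i in IH1 IH2 *.
have mB : measurable B.
  by apply: measurable_bigsetI => i iA; case: (FA i); rewrite // mem_cat iA.
have mC : measurable C.
  by apply: measurable_bigsetI => i iA; case: (FA i); rewrite // !mem_cat iA !orbT.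
have mD : measurable D.
  rewrite /D; elim: ss {IH IH1 IH2 D ust sub sub'} FA => [|u ss IH] FA.
    by rewrite big_nil.
  rewrite big_cons; apply: measurableI.
    apply/measurableC/measurable_bigsetI => i iu.
    by case: (FA i); rewrite // /= !mem_cat iu !orbT.
  apply: IH => i; rewrite !mem_cat => it; apply: FA; rewrite /= !mem_cat.
  by case/or3P: it => ->; rewrite ?orbT.
(* The complement becomes a difference of two probabilities, given by the induction hypothesis for
   [t] and for [s ++ t]. *)
have -> : ~` B `&` D `&` C = (D `&` C) `\` B by rewrite setDE -setIA setIC.
transitivity (P (D `&` C) - P (D `&` C `&` B))%E.
  apply: measureD => //; first exact: measurableI.
  by rewrite -ge0_fin_numE // fin_num_measure //; exact: measurableI.
have -> : D `&` C `&` B = D `&` (B `&` C) by rewrite -setIA [C `&` B]setIC.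
rewrite IH1 IH2 -EFinB; congr EFin; rewrite big_cat /=; ring.
Qed.
End finite_families.

(** * Probabilities of few particles and of missed walks *)

Section events.
Context {R : realType} {G : graph} {p : R} {law : probability nat R}.
Variable M : frog_model G p law.
Local Notation Omega := (fm_space M).
Local Notation P := (fm_prob M).

Definition primitive_events (j : G + (G * nat) + (G * nat)) : set_system Omega :=
  match j with
  | inl (inl x) => sigma_of (eta_ (f:=M) x)
  | inl (inr (x, i)) => sigma_of_seq (walk (f:=M) x i)
  | inr (x, i) => sigma_of (lifetime (f:=M) x i)
  end.

Lemma primitive_events_indep : mutually_independent P primitive_events.
Proof. exact: fm_indep. Qed.

Definition few_particles (N : nat) (x : G) : set Omega :=
  [set omega | (eta_ x omega < N)%N].

Lemma measurable_few_particles N x : measurable (few_particles N x).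
Proof. exact: (@eta_meas _ _ _ _ M x [set k | (k < N)%N]). Qed.

Lemma few_particles_prob N (s : seq G) (g : R) : uniq s ->
  law [set k | (N <= k)%N] = g%:E ->
  P (\big[setI/setT]_(x <- s) few_particles N x) = ((1 - g) ^+ size s)%:E.
Proof.
move=> us lawN.
have lawC : law [set k | (k < N)%N] = (1 - g)%:E.
  rewrite EFinB -lawN -probability_setC //; congr (law _).
  by apply/seteqP; split=> k /=; rewrite ltnNge => /negP.
pose A (j : G + (G * nat) + (G * nat)) : set Omega :=
  if j is inl (inl x) then few_particles N x else setT.
have := @primitive_events_indep [seq inl (inl x) | x <- s] A.
rewrite !big_map /= => ->.
- under eq_bigr => x _ do rewrite (@eta_law _ _ _ _ M x [set k | (k < N)%N]) lawC.
  by rewrite prodEFin big_const_seq count_predT -Monoid.iteropE.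
- by rewrite map_inj_uniq // => x y [].
- move=> j /mapP[x _ ->] /=; by exists [set k | (k < N)%N].
Qed.

Definition follows (x : G) (s : seq G) (i : nat) : set Omega :=
  [set omega | forall k, (k <= size s)%N -> walk x i k omega = nth x (x :: s) k].

(** Lifetime l + 1 means that step l is the last one at which the particle is alive; this has
    probability (1 - p) p^l. *)
Definition dies_at (x : G) (l : nat) (i : nat) : set Omega :=
  [set omega | lifetime x i omega = Some l.+1].

(* Asking the particle to die right after the walk costs only a constant factor
   in the probability. *)
Definition missed (x : G) (s : seq G) (N : nat) : set Omega :=
  \big[setI/setT]_(i <- iota 0 N) ~` (follows x s i `&` dies_at x (size s) i).

Lemma follows_primitive x s i : primitive_events (inl (inr (x, i))) (follows x s i).
Proof.
set D := [set A | exists (n : nat) (B : set G), A = walk (f:=M) x i n @^-1` B].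
(* Measurability is taken in the sigma-algebra generated by this single walk, as independence
   demands. *)
apply: (@measurable_forall _ (g_sigma_algebraType D) nat
  (fun k omega => (k <= size s)%N -> walk x i k omega = nth x (x :: s) k)) => k.
apply: measurable_imply; apply: sub_sigma_algebra.
by exists k, [set nth x (x :: s) k].
Qed.

Lemma measurable_follows x s i : measurable (follows x s i).
Proof.
apply: (@measurable_forall _ _ nat
  (fun k omega => (k <= size s)%N -> walk x i k omega = nth x (x :: s) k)) => k.
apply: measurable_imply; exact: (@walk_meas _ _ _ _ M x i k [set nth x (x :: s) k]).
Qed.

Lemma measurable_dies_at x l i : measurable (dies_at x l i).
Proof. exact: (@lifetime_meas _ _ _ _ M x i [set Some l.+1]). Qed.

Lemma measurable_missed x s N : measurable (missed x s N).
Proof.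
apply: measurable_bigsetI => i _; apply/measurableC/measurableI.
  exact: measurable_follows.
exact: measurable_dies_at.
Qed.

Lemma follows_prob (d : nat) x s i : (forall y : G, degree y = d) ->
  path (@adj G) x s -> P (follows x s i) = (d%:R ^- size s)%:E.
Proof.
move=> dG Ps; rewrite (walk_law M x i (nth x (x :: s)) (size s)); congr EFin.
rewrite /srw_prob eqxx mul1r -exprVn.
transitivity (\prod_(k < size s) (d%:R^-1 : R)); last first.
  by rewrite prodr_const card_ord.
apply: eq_bigr => k _; rewrite dG.
by move/(pathP x): Ps => /(_ k (ltn_ord k)) ->; rewrite div1r.
Qed.

(** Each of the N particles independently follows [s] and then dies with probability d^-l (1 - p)
    p^l, where l is the size of [s]. *)
Lemma missed_prob (d : nat) x s N : (forall y : G, degree y = d) ->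
  path (@adj G) x s ->
  P (missed x s N) = ((1 - (1 - p) * (p / d%:R) ^+ size s) ^+ N)%:E.
Proof.
move=> dG Ps.
pose A (j : G + (G * nat) + (G * nat)) : set Omega :=
  match j with
  | inl (inl x) => setT
  | inl (inr (x, i)) => follows x s i
  | inr (x, i) => dies_at x (size s) i
  end.
pose q (j : G + (G * nat) + (G * nat)) : R :=
  match j with
  | inl (inl x) => 1
  | inl (inr _) => d%:R ^- size s
  | inr _ => (1 - p) * p ^+ size s
  end.
pose j (i : nat) (b : bool) : G + (G * nat) + (G * nat) :=
  if b then inl (inr (x, i)) else inr (x, i).
(* One block per particle, made of its walk and its lifetime. *)
pose ss := [seq [seq j i b | b <- [:: true; false]] | i <- iota 0 N].
have := @independent_blocks _ _ _ P _ primitive_events A q ss [::] primitive_events_indep.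
rewrite cats0 !big_nil setIT mulr1 !big_map.
have -> : (\prod_(i <- iota 0 N)
      (1 - \prod_(k <- [seq j i b | b <- [:: true; false]]) q k)) =
    (1 - (1 - p) * (p / d%:R) ^+ size s) ^+ N.
  under eq_bigr => i _ do rewrite !big_cons big_nil mulr1 /= mulrC -mulrA -expr_div_n.
  by rewrite big_const_seq count_predT size_iota -Monoid.iteropE.
move=> <-.
- by congr (P _); apply: eq_bigr => i _; rewrite !big_cons big_nil setIT.
- apply: allpairs_uniq; rewrite ?iota_uniq // => -[i [] [k []]] _ _ //= []; by move=> ->.
- move=> _ /allpairsP[[i b] /= [_ _ ->]]; rewrite /j; case: b => /=; split.
  + exact: follows_primitive.
  + exact: measurable_follows.
  + exact: follows_prob.
  + by exists [set Some (size s).+1].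
  + exact: measurable_dies_at.
  + exact: lifetime_law.
Qed.

Lemma not_missed x s N omega : ~ missed x s N omega ->
  exists i, (i < N)%N /\ alive omega x i (size s) /\
    walk x i (size s) omega = last x s.
Proof.
rewrite /missed => nm; apply: contrapT => no; apply: nm.
rewrite big_seq; apply: (big_ind (fun S : set Omega => S omega)) => //.
move=> i; rewrite mem_iota /= add0n => iN [fo de]; apply: no; exists i.
split=> //; split; first by rewrite /alive de.
by rewrite fo // -nth_last /=; case: s {fo de} => //= a s; rewrite (nth_last).
Qed.
End events.

(** * Stages *)

(** The failure probabilities sum to at most e, which is less than the probability of A. *)
Lemma positive_intersection (disp : measure_display) (T : measurableType disp)
    (R : realType) (P : probability T R) (A : set T) (E : nat -> set T) (e : R) :
  measurable A -> (forall k, measurable (E k)) -> 0 <= e ->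
  (forall k, (P (~` E k) <= (e / (2 ^ k.+1)%:R)%:E)%E) -> (e%:E < P A)%E ->
  (0 < P (A `&` \bigcap_k E k))%E.
Proof.
move=> mA mE e0 PE PA.
have mI : measurable (A `&` \bigcap_k E k).
  by apply: measurableI => //; exact: bigcapT_measurable.
have mU : measurable (\bigcup_k ~` E k).
  by apply: bigcupT_measurable => k; exact: measurableC.
have PU : (P (\bigcup_k ~` E k) <= e%:E)%E.
  apply: (le_trans (generalized_Boole_inequality _ _ _)) => //.
    by move=> k; exact: measurableC.
  apply: (le_trans _ (epsilon_trick0 xpredT e0)).
  by apply: lee_nneseries => [k _ _|k _]; [exact: measure_ge0|exact: PE].
rewrite lt_neqAle measure_ge0 andbT; apply/eqP => P0.
have : (P A <= P (A `&` \bigcap_k E k) + P (\bigcup_k ~` E k))%E.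
  apply: (le_trans _ (measureU2 _ _ _)) => //; apply: le_measure; rewrite ?inE //.
    exact: measurableU.
  move=> w Aw; have [nE|] := pselect (exists k, ~ E k w).
    by right; case: nE => k; exists k.
  by move=> nE; left; split=> // k _; apply: contrapT => nk; apply: nE; exists k.
by rewrite -P0 add0e => PAU; move: (lt_le_trans PA (le_trans PAU PU)); rewrite ltxx.
Qed.

(** In degree d + 1, with g = P(eta >= N): first the probability that d^n given vertices all have
    fewer than N particles, then a union bound over pairs from the balls of radii n and n + 1, for
    walks of the maximal length 2n + 1. *)
Definition stage_failure_bound (R : realType) (d : nat) (p g : R) (n N : nat) : R :=
  (1 - g) ^+ (d ^ n) +
  d.+2%:R ^+ (n + n.+1) * (1 - (1 - p) * (p / d.+1%:R) ^+ (n + n.+1)) ^+ N.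

Section stages.
Context {R : realType} {G : graph} {p : R} {law : probability nat R}.
Variable M : frog_model G p law.
Variables (d : nat) (o : G).
Hypothesis tG : homogeneous_tree d.+1 G.
Local Notation Omega := (fm_space M).
Local Notation P := (fm_prob M).

(** The second clause concerns the first N walks of every vertex of the ball, whether or not these
    particles exist, so that no conditioning on the well-stocked vertex is involved. *)
Definition stage (n N : nat) (omega : Omega) : Prop :=
  (exists2 x, x \in graph_ball o n & (N <= eta_ x omega)%N) /\
  forall x y, x \in graph_ball o n -> y \in graph_ball o n.+1 ->
    exists i l, [/\ (i < N)%N, (n <= l)%N, alive omega x i l & walk x i l omega = y].

(** A measurable event inside [stage] spares a measurability proof for [stage] itself. *)
Lemma stage_event (n N : nat) (g : R) : 0 <= p <= 1 ->
  law [set k | (N <= k)%N] = g%:E ->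
  exists E : set Omega, [/\ measurable E,
    (P (~` E) <= (stage_failure_bound d p g n N)%:E)%E & E `<=` stage n N].
Proof.
move=> /andP[p0 p1] lawN; have [_ dG] := tG.
have [s [us sb ss]] := @tree_growth G o d n tG.
(* One walk is fixed for each pair; the default [[::]] is taken only where no suitable walk
   exists. *)
pose W (xy : G * G) : seq G :=
  xget [::] [set s | [/\ path (@adj G) xy.1 s, last xy.1 s = xy.2 &
  (n <= size s <= n + n.+1)%N]].
have WP x y : x \in graph_ball o n -> y \in graph_ball o n.+1 ->
    [/\ path (@adj G) x (W (x, y)), last x (W (x, y)) = y &
      (n <= size (W (x, y)) <= n + n.+1)%N].
  move=> xb yb.
  have [t Ht] := @graph_ball_walk G d.+1 o x y n n.+1 isT dG xb yb (ltnSn n).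
  exact: (@xgetPex _ [::] [set s | [/\ path (@adj G) x s, last x s = y &
    (n <= size s <= n + n.+1)%N]] (ex_intro _ t Ht)).
pose pairs := [seq (x, y) | x <- graph_ball o n, y <- graph_ball o n.+1].
pose B1 := \big[setI/setT]_(x <- s) @few_particles _ _ _ _ M N x.
pose B2 := \big[setU/set0]_(xy <- pairs) @missed _ _ _ _ M xy.1 (W xy) N.
have mB1 : measurable B1.
  by apply: measurable_bigsetI => x _; exact: measurable_few_particles.
have [mB2 PB2] : measurable B2 /\ (P B2 <= ((size pairs)%:R *
    (1 - (1 - p) * (p / d.+1%:R) ^+ (n + n.+1)) ^+ N)%:E)%E.
  apply: union_bound => [xy _|_ /allpairsP[[x y] /= [xb yb ->]]].
    exact: measurable_missed.
  have [Ps _ /andP[_ sW]] := WP x y xb yb.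
  (* Longer walks are at least as likely to be missed, so the maximal length gives a common
     bound. *)
  rewrite (missed_prob M N dG Ps) lee_fin.
  have q01 : 0 <= p / d.+1%:R <= 1.
    by rewrite divr_ge0 //= ler_pdivrMr // mul1r (le_trans p1) // ler1n.
  have le1 m : (p / d.+1%:R) ^+ m <= 1 by case/andP: q01 => *; exact: exprn_ile1.
  have ge0 m : 0 <= (p / d.+1%:R) ^+ m by case/andP: q01 => *; exact: exprn_ge0.
  have ok m : 0 <= 1 - (1 - p) * (p / d.+1%:R) ^+ m.
    rewrite subr_ge0 mulr_ile1 //; lra.
  rewrite lerXn2r ?nnegrE //.
  rewrite lerD2l lerN2; apply: ler_wpM2l; first lra.
  by case/andP: q01 => *; apply: ler_wiXn2l.
exists (~` (B1 `|` B2)); split.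
- exact/measurableC/measurableU.
- rewrite setCK; apply: (@le_trans _ _ (P B1 + P B2)%E); first exact: measureU2.
  rewrite EFinD; apply: leeD.
    by rewrite (few_particles_prob M us lawN) ss.
  by move: PB2; rewrite size_allpairs !(@size_graph_ball G o d.+1) // -expnD natrX.
- move=> omega; rewrite setCU => -[nB1 nB2]; split.
    apply: contrapT => no; apply: nB1.
    rewrite /B1 big_seq; apply: (big_ind (fun S : set Omega => S omega)) => //.
    move=> x xs; rewrite /few_particles /= ltnNge; apply/negP => Nx.
    by apply: no; exists x => //; exact: sb.
  move=> x y xb yb; have [Ps ls /andP[ns _]] := WP x y xb yb.
  have [|i [iN [ai wi]]] := @not_missed _ _ _ _ M x (W (x, y)) N omega.
    move=> mo; apply: nB2.
    rewrite /B2 -bigcup_seq; exists (x, y) => //=.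
    by apply/allpairsP; exists (x, y).
  by exists i, (size (W (x, y))); rewrite wi ls.
Qed.

(** The root's own particles activate the ball of radius n0; then a well-stocked vertex of each ball
    activates the next one, and also sends a particle to the root at age at least n. *)
Lemma stages_root_hit_io (n0 : nat) (N : nat -> nat) (omega : Omega) :
  (N n0 <= eta_ o omega)%N ->
  (forall n, (n0 <= n)%N -> stage n (N n) omega) -> root_hit_io o omega.
Proof.
move=> No st.
have ob n : o \in graph_ball o n by apply/graph_ballP; exists [::].
have act n x : (n0 <= n)%N -> x \in graph_ball o n -> activated omega o x.
  move=> /subnK <-; elim: (n - n0)%N x => [|k IH] x.
    rewrite add0n => xb; have [_ /(_ o x (ob _))] := st n0 (leqnn _).
    rewrite /= mem_cat xb => /(_ isT)[i [l [iN _ ai wi]]].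
    apply: (activated_step (activated_root omega o)) => //; split; last exact: wi.
      exact: leq_trans iN No.
    exact: ai.
  have [[y yb Ny] cover] := st (k + n0)%N (leq_addl _ _).
  rewrite addSn => xb; have [i [l [iN _ ai wi]]] := cover y x yb xb.
  by apply: (activated_step (IH _ yb)); split; [exact: leq_trans iN Ny|exact: ai|].
apply/infinite_set_natP => n.
have n0n : (n0 <= maxn n n0)%N by rewrite leq_maxr.
have [[x xb Nx] /(_ x o xb (ob _))[i [l [iN nl ai wi]]]] := st _ n0n.
have xo : particle_at omega x i l o by split=> //; exact: leq_trans iN Nx.
have [m lm hm] := root_hit_activated (act _ _ n0n xb) xo.
by exists m; split=> //; lia.
Qed.

End stages.

(** * Double exponential decay against exponential growth *)

Lemma exprn_expR_cvg0 (R : realType) (A c u e : R) : 0 < A -> 0 < c -> 1 < u -> 0 < e ->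
  exists n0 : nat, forall n, (n0 <= n)%N -> A ^+ n * expR (- (c * u ^+ n)) <= e.
Proof.
move=> A0 c0 u1 e0.
have grow (v K : R) : 1 < v -> exists n0, forall n, (n0 <= n)%N -> K <= v ^+ n.
  move=> v1; have bern (n : nat) : 1 + n%:R * (v - 1) <= v ^+ n.
    elim: n => [|n IH]; first by rewrite mul0r addr0 expr0.
    rewrite exprS -natr1; have n0 : 0 <= n%:R :> R by [].
    have := ler_wpM2l (ltW (lt_trans ltr01 v1)) IH.
    by have := mulr_ge0 n0 (sqr_ge0 (v - 1)); rewrite expr2; lra.
  exists (Num.truncn (K / (v - 1))).+1 => n nn; apply: le_trans (bern n).
  have v10 : 0 < v - 1 by lra.
  have : K / (v - 1) < n%:R.
    by apply: lt_le_trans (truncnS_gt _) _; rewrite ler_nat.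
  by rewrite ltr_pdivrMr // => H; lra.
(* With K = k + 1 and u^K >= 2A, the bound exp(z) >= (z/K)^K at z = c u^n gives exp(c u^n) >= b
   (2A)^n. The product is then at most 1 / (b 2^n). *)
have [k hk] := grow u (2 * A) u1.
have {}hk := hk k.+1 (leqnSn _).
set b := (c / k.+1%:R) ^+ k.+1.
have b0 : 0 < b by rewrite exprn_gt0 // divr_gt0.
have lower n : b * (2 * A) ^+ n <= expR (c * u ^+ n).
  have -> : c * u ^+ n = k.+1%:R * (c * u ^+ n / k.+1%:R).
    by rewrite [RHS]mulrC divfK // pnatr_eq0.
  rewrite expRM_natl.
  apply: (@le_trans _ _ ((c * u ^+ n / k.+1%:R) ^+ k.+1)).
    rewrite [X in _ <= X ^+ _]mulrAC [leRHS]exprMn -exprM mulnC exprM.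
    rewrite ler_wpM2l ?(ltW b0) //.
    by rewrite lerXn2r // nnegrE ?exprn_ge0 //; lra.
  have un0 : 0 <= c * u ^+ n / k.+1%:R.
    by rewrite divr_ge0 // mulr_ge0 ?exprn_ge0 //; lra.
  rewrite lerXn2r ?nnegrE ?expR_ge0 //.
  by apply: le_trans (expR_ge1Dx _); rewrite lerDr.
have [n0 hn] := grow 2 (1 / (b * e)) (ltr1n _ 2).
exists n0 => n /hn le2; rewrite expRN ler_pdivrMr ?expR_gt0 //.
apply: le_trans (ler_wpM2l (ltW e0) (lower n)).
rewrite exprMn; have An0 : 0 < A ^+ n by exact: exprn_gt0.
rewrite ler_pdivrMr in le2; last exact: mulr_gt0.
have := ler_wpM2r (ltW An0) le2; lra.
Qed.

(** * Choice of the parameters *)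

Lemma onem_exprn_le_expR (R : realType) (x y : R) (m : nat) :
  x <= 1 -> y <= x * m%:R -> (1 - x) ^+ m <= expR (- y).
Proof.
move=> x1 yx; apply: (@le_trans _ _ (expR (- x) ^+ m)).
  by rewrite lerXn2r ?nnegrE ?expR_ge0 ?subr_ge0 // expR_ge1Dx.
by rewrite -expRM_natl ler_expR; lra.
Qed.

Lemma powR_exprn (R : realType) (a b : R) (n : nat) :
  0 <= a -> (a ^+ n) `^ b = (a `^ b) ^+ n.
Proof.
move=> a0; elim: n => [|n IH]; first by rewrite !expr0 powR1.
by rewrite !exprS powRM ?exprn_ge0 // IH.
Qed.

(** In logarithms, y < t1 and 2 t1 < t2 < x/c are wanted, and there is room because 2y < x/c. Here
    [a] will be the growth rate of the particle numbers and [D] the value of (d + 1)/p. *)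
Lemma growth_rates (R : realType) (d : nat) (b : R) : (2 <= d)%N ->
  b < ln d%:R / (2 * ln d.+1%:R) ->
  exists a D c : R, [/\ b <= c, 0 < c, d.+1%:R < D, D ^+ 2 < a & a `^ c < d%:R].
Proof.
move=> d2; set x := ln d%:R; set y := ln d.+1%:R => bxy.
have x0 : 0 < x by rewrite ln_gt0 // ltr1n.
have y0 : 0 < y by rewrite ln_gt0 // ltr1n; lia.
(* The exponent is raised if necessary to be positive, as b may be negative or zero. *)
pose c := Num.max b (x / (4 * y)).
have c0 : 0 < c by rewrite lt_max divr_gt0 ?orbT // mulr_gt0.
have cxy : c < x / (2 * y).
  rewrite gt_max bxy /= ltr_pM2l // ltf_pV2 ?posrE ?mulr_gt0 //; lra.
have xc : 2 * y < x / c.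
  by rewrite ltr_pdivlMr // mulrC -ltr_pdivlMr // mulr_gt0.
(* Of the gap x/c - 2y, 2 t1 uses one half and t2 three quarters. *)
pose t1 := y + (x / c - 2 * y) / 4; pose t2 := 2 * y + 3 * (x / c - 2 * y) / 4.
exists (expR t2), (expR t1), c; split => //.
- by rewrite le_max lexx.
- by rewrite -[ltLHS]lnK ?posrE // ltr_expR /t1 -/y; lra.
- by rewrite -expRM_natl ltr_expR /t1 /t2; lra.
- rewrite /powR gt_eqF ?expR_gt0 // expRK -[ltRHS]lnK ?posrE ?ltr0n; last lia.
  rewrite ltr_expR -/x mulrC -ltr_pdivlMr // /t2; lra.
Qed.

Lemma frog_parameters (R : realType) (d : nat) (b : R) (g : nat -> R) (n1 : nat) :
  (2 <= d)%N -> b < ln d%:R / (2 * ln d.+1%:R) ->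
  (forall n, (n1 <= n)%N -> 1 / n%:R `^ b <= g n) -> (forall n, g n <= 1) ->
  exists (p : R) (N : nat -> nat) (n0 : nat) (e : R), [/\ 0 < p < 1, 0 <= e,
    e < g (N n0) &
    forall k, stage_failure_bound d p (g (N (n0 + k)%N)) (n0 + k) (N (n0 + k)%N)
      <= e / (2 ^ k.+1)%:R].
Proof.
move=> d2 /(growth_rates d2)[a [D [c [bc c0 dD Da acd]]]] gb g1.
have dR2 : 2 <= d%:R :> R by rewrite ler_nat.
have d1E : d.+1%:R = d%:R + 1 :> R by rewrite -natr1.
have d2E : d.+2%:R = d%:R + 2 :> R by rewrite -natr1 d1E; lra.
have D0 : 0 < D by lra.
have D3 : 3 < D by lra.
have D2 : 9 < D ^+ 2 by rewrite expr2; nra.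
have a9 : 9 < a by lra.
have a0 : 0 < a by lra.
have h0 : 0 < a `^ c by rewrite powR_gt0.
set h := a `^ c in acd h0.
(* Then p/(d + 1) = 1/D, so a living particle follows a walk of length l with probability of order
   D^-l. *)
pose p := d.+1%:R / D; exists p.
have p01 : 0 < p < 1 by rewrite divr_gt0 //= ltr_pdivrMr // mul1r.
have pd : p / d.+1%:R = D^-1 by rewrite /p mulrAC divff ?mul1r // pnatr_eq0.
pose N n := (Num.truncn (a ^+ n)).+1; exists N.
have an1 n : 1 <= a ^+ n by rewrite exprn_ege1 //; lra.
have Nlb n : a ^+ n < (N n)%:R by exact: truncnS_gt.
have Nub n : (N n)%:R <= 2 * a ^+ n.
  have := an1 n; have : (Num.truncn (a ^+ n))%:R <= a ^+ n.
    by rewrite truncn_le // exprn_ge0 // ltW.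
  by rewrite /N -natr1; lra.
have nN n : (n <= N n)%N.
  rewrite ltnW // -(ltr_nat R); apply: le_lt_trans (Nlb n).
  apply: (@le_trans _ _ (2 ^+ n)); first by rewrite -natrX ler_nat ltnW // ltn_expl.
  by rewrite lerXn2r ?nnegrE //; lra.
(* The bound N_n <= 2 a^n gives N_n^-c >= c1 / h^n. *)
pose c1 : R := (2 `^ c)^-1.
have c10 : 0 < c1 by rewrite invr_gt0 powR_gt0.
have gN n : (n1 <= n)%N -> c1 / h ^+ n <= g (N n).
  move=> nn; apply: le_trans (gb _ (leq_trans nn (nN n))).
  rewrite /c1 div1r -invfM lef_pV2 ?posrE ?mulr_gt0 ?exprn_gt0 ?powR_gt0 //.
  apply: (@le_trans _ _ ((N n)%:R `^ c)); first by rewrite ler_powR // ler1n.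
  rewrite -powR_exprn ?(ltW a0) // -powRM ?exprn_ge0 ?(ltW a0) //.
  by rewrite ge0_ler_powR ?nnegrE ?mulr_ge0 ?exprn_ge0 ?(ltW a0) ?(ltW c0).
(* The factor 1/D is the odd step of a walk of length 2n + 1. *)
pose c2 := (1 - p) / D.
have c20 : 0 < c2 by rewrite divr_gt0 // subr_gt0; case/andP: p01.
have u1 : 1 < d%:R / h by rewrite ltr_pdivlMr // mul1r.
have u2 : 1 < a / D ^+ 2 by rewrite ltr_pdivlMr ?exprn_gt0 // mul1r.
(* The factor (2d)^n covers both the size d^-n0 of e and the weights 2^-k; the square of d + 2
   counts the pairs of vertices. *)
have A1 : 0 < 2 * d%:R :> R by lra.
have A2 : 0 < 2 * d%:R * d.+2%:R ^+ 2 :> R by rewrite mulr_gt0 // exprn_gt0.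
have e1 : 0 < c1 / 8 by rewrite divr_gt0.
have e2 : 0 < c1 / 8 / d.+2%:R by rewrite divr_gt0.
have [m1 H1] := exprn_expR_cvg0 A1 c10 u1 e1.
have [m2 H2] := exprn_expR_cvg0 A2 c20 u2 e2.
pose n0 := maxn n1 (maxn m1 m2); exists n0.
have dn0 m : 0 < d%:R ^+ m :> R by rewrite exprn_gt0 //; lra.
(* Half of a lower bound for P(eta >= N_n0), since h < d. *)
pose e := c1 / d%:R ^+ n0 / 2; exists e.
have e0 : 0 < e by rewrite /e !divr_gt0.
split => //; first exact: ltW.
  have n1n0 : (n1 <= n0)%N by rewrite leq_maxl.
  apply: lt_le_trans (gN _ n1n0); apply: (@lt_le_trans _ _ (c1 / d%:R ^+ n0)).
    by rewrite /e ltr_pdivrMr // ltr_pMr ?divr_gt0 // ltr1n.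
  rewrite ler_pM2l // lef_pV2 ?posrE ?dn0 ?(exprn_gt0 _ h0) //.
  by rewrite lerXn2r ?nnegrE ?(ltW h0) ?(ltW acd).
move=> k; set n := (n0 + k)%N.
have n0n : (n0 <= n)%N by rewrite leq_addr.
have n1n : (n1 <= n)%N by rewrite (leq_trans _ n0n) // leq_maxl.
have m1n : (m1 <= n)%N by rewrite (leq_trans _ n0n) // !leq_max leqnn !orbT.
have m2n : (m2 <= n)%N by rewrite (leq_trans _ n0n) // !leq_max leqnn !orbT.
have F1 : (1 - g (N n)) ^+ (d ^ n) <= expR (- (c1 * (d%:R / h) ^+ n)).
  apply: onem_exprn_le_expR => //.
  rewrite natrX expr_div_n mulrCA mulrC ler_pM2r //; exact: gN.
have F2 : (1 - (1 - p) * (p / d.+1%:R) ^+ (n + n.+1)) ^+ N n <=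
    expR (- (c2 * (a / D ^+ 2) ^+ n)).
  have E : (1 - p) * (p / d.+1%:R) ^+ (n + n.+1) = c2 / (D ^+ 2) ^+ n.
    rewrite pd addnS exprS addnn -mul2n exprM !exprVn /c2; ring.
  apply: onem_exprn_le_expR.
    case/andP: p01 => p0 p1; rewrite pd mulr_ile1 ?exprn_ge0 ?exprn_ile1 ?invr_ge0 ?(ltW D0) //; try lra.
    by rewrite invf_le1 //; lra.
  rewrite E expr_div_n mulrCA mulrC ler_pM2l; last by rewrite divr_gt0 // !exprn_gt0.
  exact: ltW.
have G1 := H1 _ m1n; have G2 := H2 _ m2n.
rewrite /stage_failure_bound.
have An : 0 < (2 * d%:R) ^+ n :> R by exact: exprn_gt0.
(* Each of the two terms of the bound, multiplied by (2d)^n, is at most c1/8. *)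
apply: (@le_trans _ _ (c1 / 4 / (2 * d%:R) ^+ n)).
  rewrite ler_pdivlMr // mulrDl.
  have T1 : (1 - g (N n)) ^+ (d ^ n) * (2 * d%:R) ^+ n <= c1 / 8.
    by apply: le_trans G1; rewrite mulrC ler_pM2l.
  have T2 : d.+2%:R ^+ (n + n.+1) * (1 - (1 - p) * (p / d.+1%:R) ^+ (n + n.+1)) ^+ N n *
      (2 * d%:R) ^+ n <= c1 / 8.
    rewrite ler_pdivlMr // in G2; apply: le_trans G2.
    set q := _ ^+ N n in F2 *; set r := expR _ in F2 *.
    rewrite [(_ * _ ^+ 2) ^+ n]exprMn -[in leRHS]exprM mul2n -addnn addnS exprS.
    have -> : d.+2%:R * d.+2%:R ^+ (n + n) * q * (2 * d%:R) ^+ n =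
      (2 * d%:R) ^+ n * d.+2%:R ^+ (n + n) * d.+2%:R * q by ring.
    rewrite [leRHS]mulrAC ler_pM2l // !mulr_gt0 // exprn_gt0.
  lra.
rewrite /e natrX exprS.
have -> : c1 / d%:R ^+ n0 / 2 / (2 * 2 ^+ k) = c1 / 4 / (d%:R ^+ n0 * 2 ^+ k).
  by field; rewrite ?gt_eqF ?exprn_gt0 //; lra.
rewrite ler_pM2l ?divr_gt0 // lef_pV2 ?posrE ?mulr_gt0 ?dn0 ?exprn_gt0 //.
(* The last factor is at least 1. *)
have -> : (2 * d%:R) ^+ n = d%:R ^+ n0 * 2 ^+ k * (2 ^+ n0 * d%:R ^+ k) :> R.
  by rewrite /n exprMn !exprD; ring.
rewrite ler_peMr ?mulr_ge0 ?exprn_ge0 //.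
by rewrite mulr_ege1 ?exprn_ege1 //; lra.
Qed.

(** * Conclusion for the critical parameter *)

Theorem theorem1p11 (R : realType) (d : nat) (Td : graph) (o : Td)
    (disp : measure_display) (Omega : measurableType disp)
    (P : probability Omega R) (eta : {RV P >-> nat})
    (M : forall p : R, 0 <= p <= 1 -> frog_model Td p (distribution P eta)) :
  (3 <= d)%N ->
  homogeneous_tree d Td ->
  (0 < P [set w | (1 <= eta w)%N])%E ->
  (exists2 beta : R,
     beta < ln (d%:R - 1) / (2 * ln d%:R) &
     \forall n \near \oo,
       ((1 / (n%:R `^ beta))%:E <= P [set w | (n <= eta w)%N])%E) ->
  p_u o M < 1.
Proof.
(* From here on the degree is [d.+1], and d is the branching number. *)
case: d => // d d3 tG _ [b]; rewrite -natr1 addrK natr1 => hb [n1 _ Hn].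
pose law := distribution P eta.
pose g n : R := fine (law [set k | (n <= k)%N]).
have lawg n : law [set k | (n <= k)%N] = (g n)%:E.
  by rewrite fineK // fin_num_measure.
have g1 n : g n <= 1 by rewrite -lee_fin -lawg probability_le1.
have gb n : (n1 <= n)%N -> 1 / n%:R `^ b <= g n.
  by move=> nn; rewrite -lee_fin -lawg; exact: Hn.
have [p [N [n0 [e [p01 e0 eg Hk]]]]] := @frog_parameters R d b g n1 d3 hb gb g1.
have hp : 0 <= p <= 1 by case/andP: p01 => *; rewrite !ltW.
have /choice[E HE] : forall k, exists E : set (fm_space (M p hp)), [/\ measurable E,
    (fm_prob (M p hp) (~` E) <= (stage_failure_bound d p (g (N (n0 + k)%N))
      (n0 + k) (N (n0 + k)%N))%:E)%E &
    E `<=` @stage _ _ _ _ (M p hp) o (n0 + k) (N (n0 + k)%N)].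
  by move=> k; exact: stage_event.
pose A0 : set (fm_space (M p hp)) := [set omega | (N n0 <= eta_ o omega)%N].
have mA0 : measurable A0 by exact: (@eta_meas _ _ _ _ (M p hp) o [set k | (N n0 <= k)%N]).
have pos : (0 < fm_prob (M p hp) (root_hit_io o))%E.
  apply: (@lt_le_trans _ _ (fm_prob (M p hp) (A0 `&` \bigcap_k E k))).
    apply: (@positive_intersection _ _ _ _ _ _ e) => // [k|k|].
    - by have [] := HE k.
    - have [_ PE _] := HE k; apply: le_trans PE _; rewrite lee_fin; exact: Hk.
    - rewrite (@eta_law _ _ _ _ (M p hp) o [set k | (N n0 <= k)%N]).
      by move: eg; rewrite -lte_fin -lawg.
  apply: le_measure; rewrite ?inE.
  - apply: measurableI => //; apply: bigcapT_measurable => k; by have [] := HE k.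
  - exact: measurable_root_hit_io.
  - move=> omega [A0w Ew]; apply: (stages_root_hit_io (N := N) A0w) => n /subnKC <-.
    by have [_ _] := HE (n - n0)%N; apply; exact: Ew.
(* The set contains p, which excludes the conventional value 1 and bounds the infimum by p < 1. *)
rewrite /p_u; case: asboolP => [A0E|_].
  suff : (set0 : set R) p by [].
  by rewrite -A0E; exists hp.
apply: (@le_lt_trans _ _ p); last by case/andP: p01.
apply: ge_inf; last by exists hp.
by exists 0 => x [/andP[x0 _] _].
Qed.
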